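(* Let $\mathfrak{g}$ be a unimodular integrable LCK Lie algebra with Lee vector $U$ and anti-Lee vector $V$. Then $\mathfrak{h}=\langle U,V\rangle^\perp$ is a Kähler abelian ideal of $\mathfrak{g}$; that is, $\mathfrak{h}$ is an abelian $J$-invariant ideal which, with the restrictions of $g$ and $J$, is a Kähler Lie algebra.
   Context: Lie algebras are real and finite-dimensional; for $\alpha\in\mathfrak{g}^*$ the Chevalley-Eilenberg differential satisfies $d\alpha(X,Y)=-\alpha([X,Y])$, and for a $2$-form $\Omega$, $d\Omega(X,Y,Z)=-\Omega([X,Y],Z)-\Omega([Y,Z],X)-\Omega([Z,X],Y)$. An LCK structure on a Lie algebra $\mathfrak{g}$ of dimension $2n+2$ ($n\ge1$) consists of a positive definite inner product $g$, an endomorphism $J$ with $J^2=-\mathrm{Id}$ and $N_J(X,Y)=[JX,JY]-[X,Y]-J[JX,Y]-J[X,JY]=0$ for all $X,Y$, such that $\Omega(X,Y)=g(X,JY)$ is a $2$-form, and $1$-forms $\theta,\eta\in\mathfrak g^*$ with $d\Omega=\theta\wedge\Omega$, $d\theta=0$, and $\eta(X)=-\theta(JX)$. The Lee vector $U$ and anti-Lee vector $V$ are the metric duals of $\theta$ and $\eta$ (so $V=JU$). By rescaling the metric it is always assumed that $|\theta|=1$. The LCK Lie algebra is integrable if $\eta\wedge d\eta=0$. A Lie algebra is unimodular if $\mathrm{tr}(\mathrm{ad}_X)=0$ for all $X$. A Kähler Lie algebra is a Lie algebra with an inner product $g$ and an endomorphism $J$ with $J^2=-\mathrm{Id}$, $N_J=0$,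 $g(JX,JY)=g(X,Y)$, and $d\omega=0$ for $\omega(X,Y)=g(X,JY)$. *)

(* Defs.v *)
From HB Require Import structures.
From mathcomp Require Import all_boot all_order all_algebra.
From mathcomp Require Import reals.

Set Implicit Arguments.
Unset Strict Implicit.
Unset Printing Implicit Defensive.

Import Order.TTheory GRing.Theory Num.Theory.
Local Open Scope ring_scope.

Section LieAlgebras.
Variables (R : realType) (T : vectType R).

Definition lie_bracket (br : {bilinear T -> T -> T}) : Prop :=
  (forall X, br X X = 0) /\
  (forall X Y Z, br X (br Y Z) + br Y (br Z X) + br Z (br X Y) = 0).

(* \tr (passmx.mxof e e f) does not depend on the choice of the basis e. *)
Definition unimodular (br : {bilinear T -> T -> T}) : Prop :=
  forall X, \tr (passmx.mxof (vbasis {:T}) (vbasis {:T}) (linfun (br X))) = 0.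

Definition ideal (br : {bilinear T -> T -> T}) (h : {vspace T}) : Prop :=
  forall X Y, Y \in h -> br X Y \in h.

Definition abelian_on (br : {bilinear T -> T -> T}) (h : {vspace T}) : Prop :=
  {in h &, forall X Y, br X Y = 0}.

(* Chevalley-Eilenberg differential of 1-forms and of 2-forms, and the wedge
   product of a 1-form and a 2-form, with the normalisation
   (a /\ b)(X, Y) = a X * b Y - a Y * b X on 1-forms (no 1/k! factors). *)
Definition dform1 (br : {bilinear T -> T -> T}) (a : T -> R) : T -> T -> R :=
  fun X Y => - a (br X Y).

Definition dform2 (br : {bilinear T -> T -> T}) (w : T -> T -> R) :
    T -> T -> T -> R :=
  fun X Y Z => - w (br X Y) Z - w (br Y Z) X - w (br Z X) Y.

Definition wedge12 (a : T -> R) (w : T -> T -> R) : T -> T -> T -> R :=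
  fun X Y Z => a X * w Y Z + a Y * w Z X + a Z * w X Y.

Definition nijenhuis (br : {bilinear T -> T -> T}) (J : 'End(T)) :
    T -> T -> T :=
  fun X Y => br (J X) (J Y) - br X Y - J (br (J X) Y) - J (br X (J Y)).

Definition complex_structure (br : {bilinear T -> T -> T}) (J : 'End(T)) :
    Prop :=
  (forall X, J (J X) = - X) /\ (forall X Y, nijenhuis br J X Y = 0).

Definition fundamental_form (g : {dot T for idfun}) (J : 'End(T)) :
    T -> T -> R :=
  fun X Y => g X (J Y).

(* lck_two_form says that the fundamental form, which is bilinear by
   construction, is alternating. *)
Record lck_structure (br : {bilinear T -> T -> T}) (g : {dot T for idfun})
    (J : 'End(T)) (theta eta : 'Hom(T, R^o)) : Prop := LckStructure {
  lck_complex : complex_structure br J;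
  lck_two_form : forall X, fundamental_form g J X X = 0;
  lck_dfundamental : forall X Y Z,
    dform2 br (fundamental_form g J) X Y Z
      = wedge12 theta (fundamental_form g J) X Y Z;
  lck_theta_closed : forall X Y, dform1 br theta X Y = 0;
  lck_eta : forall X, eta X = - theta (J X)
}.

Definition integrable (br : {bilinear T -> T -> T}) (eta : 'Hom(T, R^o)) :
    Prop :=
  forall X Y Z, wedge12 eta (dform1 br eta) X Y Z = 0.

Definition metric_dual (g : {dot T for idfun}) (a : 'Hom(T, R^o)) (A : T) :
    Prop :=
  forall X, a X = g A X.

Record kahler_lie_algebra (br : {bilinear T -> T -> T})
    (g : {dot T for idfun}) (J : 'End(T)) : Prop := KahlerLieAlgebra {
  kahler_lie : lie_bracket br;
  kahler_complex : complex_structure br J;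
  kahler_hermitian : forall X Y, g (J X) (J Y) = g X Y;
  kahler_closed : forall X Y Z, dform2 br (fundamental_form g J) X Y Z = 0
}.

End LieAlgebras.

(* Restrictions to a subspace h, seen as a vector space [subvs_of h]. The
   projection vsproj is the identity on h, so [bracket_on] and [endo_on] are
   the restrictions of br and J as soon as br and J preserve h; for other h
   they are junk. *)
Section Restriction.
Variables (R : realType) (T : vectType R) (h : {vspace T}).

Definition bracket_on (br : {bilinear T -> T -> T}) (x y : subvs_of h) :
    subvs_of h :=
  vsproj h (br (vsval x) (vsval y)).

Definition dot_on (g : {dot T for idfun}) (x y : subvs_of h) : R :=
  g (vsval x) (vsval y).

Definition endo_on (J : 'End(T)) : 'End(subvs_of h) :=
  (linfun (vsproj h) \o J \o linfun vsval)%VF.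

Fact bracket_on_bilinear (br : {bilinear T -> T -> T}) :
  bilinear_for *:%R *:%R (bracket_on br).
Proof.
split=> u a x y.
  by rewrite /bracket_on linearP linearPl linearP.
by rewrite /bracket_on !linearP.
Qed.

HB.instance Definition _ (br : {bilinear T -> T -> T}) :=
  bilinear_isBilinear.Build R (subvs_of h) (subvs_of h) (subvs_of h)
    *:%R *:%R (bracket_on br) (bracket_on_bilinear br).

Fact dot_on_bilinear (g : {dot T for idfun}) :
  bilinear_for *%R (idfun \; *%R) (dot_on g).
Proof.
split=> u a x y.
  by rewrite /dot_on linearP linearPl.
by rewrite /dot_on !linearP.
Qed.

HB.instance Definition _ (g : {dot T for idfun}) :=
  bilinear_isBilinear.Build R (subvs_of h) (subvs_of h) R
    *%R (idfun \; *%R) (dot_on g) (dot_on_bilinear g).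

Fact dot_on_hermitian (g : {dot T for idfun}) x y :
  dot_on g x y = (-1) ^+ false * idfun (dot_on g y x).
Proof. exact: hermC. Qed.

HB.instance Definition _ (g : {dot T for idfun}) :=
  isHermitianSesquilinear.Build R (subvs_of h) false idfun (dot_on g)
    (dot_on_hermitian g).

Fact dot_on_gt0 (g : {dot T for idfun}) x : x != 0 -> 0 < dot_on g x x.
Proof. by move=> x0; apply: neq0_dnorm_gt0. Qed.

HB.instance Definition _ (g : {dot T for idfun}) :=
  isDotProduct.Build R (subvs_of h) (dot_on g) (@dot_on_gt0 g).

End Restriction.

(* Main.v *)
Require Import Defs.
From HB Require Import structures.
From mathcomp Require Import all_boot all_order all_algebra.
From mathcomp Require Import reals.
From mathcomp Require Import ring lra.

Set Implicit Arguments.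
Unset Strict Implicit.
Unset Printing Implicit Defensive.

Import Order.TTheory GRing.Theory Num.Theory.
Local Open Scope ring_scope.

(** Write h for the orthogonal complement of the Lee vector U and of V = JU,
    and D, E for the restrictions of ad U and ad V to h.

    That h is a J-invariant ideal is formal. The kernel of theta contains all
    brackets because theta is closed, the kernel of eta is a subalgebra by
    integrability, and h is their intersection, so h and U act on h; the
    vanishing of N_J at U then gives the same for V. Evaluating d(Omega) =
    theta /\ Omega on triples containing U or V shows that [U, V] = c V and
    that M := D + 1/2 and E lie in sp(h, Omega). Hence [D, E] = c E by the
    Jacobi identity, and N_J(U, -) = 0 becomes [E, J] = M + JMJ. Since
    elements of sp are traceless, tr D = -dim h / 2 = -n, and unimodularity
    applied to U gives c = n, where dim g = 2n + 2.

    The hard part is that h is abelian. The relations between M and E say that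
    the orbit of J under the ax+b group generated by U and V is a holomorphic
    curve in the Siegel half-space of complex structures compatible with
    Omega. A trace identity ([commutator_eq0]) turns this into rigidity: M is
    a normal operator, and S := M + M^T satisfies S^3 = n^2 S
    ([holomorphic_pair_normal]). Now D is a derivation of h and is normal, and
    the adjoint of a normal derivation is again a derivation
    ([adjoint_normal_derivation]); hence S - 1 = D + D^T is a derivation. A
    bracket of vectors of S-weights p and q has S-weight p + q - 1, but all
    weights lie in {-n, 0, n}, which is impossible when n >= 2
    ([bilinear_weight_eq0]). When n = 1 the algebra h is a plane, and it is
    unimodular because g is; a unimodular plane is abelian
    ([unimodular_plane_abelian]).

    Once h is abelian and J-invariant, the remaining conditions on a Kaehler
    Lie algebra only involve the metric and J^2 = -1. *)

(** * Rigidity of a holomorphic pair of symplectic matrices *)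

Section TraceIdentity.
Variables (R : realFieldType) (N : nat).
Implicit Types A P S M E J X : 'M[R]_N.

Lemma mxtrace_tr_mul_ge0 X : 0 <= \tr (X^T *m X).
Proof.
apply: sumr_ge0 => i _; rewrite mxE; apply: sumr_ge0 => j _.
by rewrite mxE -expr2 sqr_ge0.
Qed.

Lemma mxtrace_tr_mul_eq0 X : \tr (X^T *m X) = 0 -> X = 0.
Proof.
have ge0 i j : 0 <= X^T i j * X j i by rewrite mxE -expr2 sqr_ge0.
move=> /psumr_eq0P tr0; apply/matrixP => j i; rewrite [RHS]mxE.
have /psumr_eq0P row0 : \sum_j X^T i j * X j i = 0.
  rewrite -[RHS](tr0 _ i) ?mxE // => l _; rewrite mxE.
  by apply: sumr_ge0 => m _; apply: ge0.
have /eqP := row0 (fun l _ => ge0 i l) j isT.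
by rewrite mxE -expr2 sqrf_eq0 => /eqP.
Qed.

(** With X = [A, P] and Y = [A, S], invariance of the trace gives
    tr X^2 = - 2 tr (S^2 [A, P]) = 2 tr (P [A, S^2]) = 2 tr ((SP + PS) Y)
    = 2 tr ((kS - Y) Y) = - 2 tr Y^2. As X and Y are symmetric, both sides are
    sums of squares up to sign, so X = Y = 0. *)
Lemma commutator_eq0 A P S (k : R) : P^T = P -> S^T = S ->
    A *m P - P *m A = k *: P - 2 *: (S *m S) ->
    A *m S - S *m A = k *: S - (S *m P + P *m S) ->
  k *: P = 2 *: (S *m S) /\ k *: S = S *m P + P *m S.
Proof.
move=> Ps Ss AP AS.
set X := k *: P - 2 *: (S *m S) in AP *.
set Y := k *: S - (S *m P + P *m S) in AS *.
have Xs : X^T = X by rewrite /X linearB !linearZ /= trmx_mul Ps Ss.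
have Ys : Y^T = Y.
  by rewrite /Y linearB linearZ linearD /= !trmx_mul Ps Ss [P *m S + _]addrC.
have trB U V : \tr (U - V) = \tr U - \tr V :> R by rewrite linearB.
have trX : \tr (X *m X) = 2 * (\tr (S *m S *m P *m A) - \tr (S *m S *m A *m P)).
  rewrite -{2}AP /X !(mulmxBl, mulmxBr) -!scalemxAl !mulmxA.
  rewrite !(trB, mxtraceZ, mxtraceD) (mxtrace_mulC (P *m A) P) !mulmxA.
  by ring.
have trY : \tr (Y *m Y) = \tr (S *m S *m A *m P) - \tr (S *m S *m P *m A).
  rewrite -{2}AS /Y !(mulmxBl, mulmxBr, mulmxDl) -!scalemxAl !mulmxA.
  rewrite !(trB, mxtraceZ, mxtraceD) (mxtrace_mulC (S *m A) S).
  rewrite (mxtrace_mulC (S *m P *m A) S) (mxtrace_mulC (P *m S *m A) S).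
  have -> : \tr (P *m S *m S *m A) = \tr (S *m S *m A *m P).
    by rewrite -!mulmxA mxtrace_mulC !mulmxA.
  by rewrite !mulmxA; ring.
have geX : 0 <= \tr (X *m X) by rewrite -{1}Xs mxtrace_tr_mul_ge0.
have geY : 0 <= \tr (Y *m Y) by rewrite -{1}Ys mxtrace_tr_mul_ge0.
have X0 : X = 0 by apply: mxtrace_tr_mul_eq0; rewrite Xs; lra.
have Y0 : Y = 0 by apply: mxtrace_tr_mul_eq0; rewrite Ys; lra.
by split; apply/eqP; rewrite -subr_eq0 -/X -/Y ?X0 ?Y0.
Qed.

(** The condition M^T = JMJ says that M is in sp for the symplectic form with
    matrix J. The last hypothesis reads [E, J] = J [M, J], the Cauchy-Riemann
    equation for the orbit of J under the group generated by M and E. Setting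
    A = M - M^T and S = M + M^T, it says that P = S + 2JE commutes with J;
    then [M, E] = kE splits into its parts that commute and anticommute with
    J, and these are the two relations of [commutator_eq0], with 2k in place
    of k. *)
Lemma holomorphic_pair_normal J M E (k : R) :
    J *m J = - 1%:M -> J^T = - J ->
    M^T = J *m M *m J -> E^T = J *m E *m J ->
    M *m E - E *m M = k *: E ->
    E *m J - J *m E = M + J *m M *m J ->
  M *m M^T = M^T *m M /\
  (M + M^T) *m (M + M^T) *m (M + M^T) = k ^+ 2 *: (M + M^T).
Proof.
move=> JJ Jt Mt Et ME EJ.
have JJr X : J *m (J *m X) = - X by rewrite mulmxA JJ mulNmx mul1mx.
have JJl X : X *m J *m J = - X by rewrite -mulmxA JJ mulmxN mulmx1.
have [S defS] : {S | S = M + M^T} by exists (M + M^T).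
have [A defA] : {A | A = M - M^T} by exists (M - M^T).
have [P defP] : {P | P = S + 2 *: (J *m E)} by exists (S + 2 *: (J *m E)).
rewrite -defS.
have JS : J *m S = - (S *m J).
  by rewrite defS Mt mulmxDr mulmxDl -!mulmxA JJr !mulmxA JJl opprB addrC.
have JA : J *m A = A *m J.
  by rewrite defA Mt mulmxBr mulmxBl -!mulmxA JJr !mulmxA JJl !opprK addrC.
have JP : J *m P = P *m J.
  have -> : P = S + J *m E + J *m E by rewrite defP scaler_nat mulr2n addrA.
  rewrite !(mulmxDr, mulmxDl) JJr JS -mulmxA.
  have -> : E *m J = S + J *m E by rewrite defS Mt -EJ subrK.
  rewrite mulmxDr JJr JS.
  move: (S *m J) => Z; apply/matrixP => i j; rewrite !mxE; ring.
have St : S^T = S by rewrite defS linearD /= trmxK addrC.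
have Pt : P^T = P.
  rewrite defP linearD linearZ /= St trmx_mul Jt Et mulmxN JJl.
  by rewrite opprK.
have eE : 2 *: E = J *m (S - P).
  rewrite defP mulmxBr mulmxDr -scalemxAr JJr.
  by rewrite opprD addrA subrr sub0r scalerN opprK.
have eM : 2 *: M = S + A.
  by rewrite defS defA scaler_nat mulr2n addrA addrAC addrK.
have SAJ : (S + A) *m J = J *m (A - S).
  by rewrite mulmxBr mulmxDl JS JA opprK addrC.
(* Multiplying [M, E] = kE by J makes it an equation in A, S and P alone. *)
have rel : (A - S) *m (S - P) - (S - P) *m (S + A) = (2 * k) *: (S - P).
  have := congr1 (fun X => - (J *m (4 *: X))) ME.
  have -> : 4 *: (M *m E - E *m M)
      = J *m ((A - S) *m (S - P) - (S - P) *m (S + A)).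
    rewrite (mulmxBr J (_ *m _)) !(mulmxA J) -SAJ -eE -eM.
    rewrite -[_ *m J *m _]mulmxA -eE.
    rewrite -!scalemxAl -!scalemxAr !scalerA -scalerBr.
    by congr (_ *: _); ring.
  rewrite JJr opprK => ->.
  have -> : 4 *: (k *: E) = (2 * k) *: (2 *: E).
    by rewrite !scalerA; congr (_ *: _); ring.
  by rewrite eE -scalemxAr JJr scalerN opprK.
(* Y commutes with J and Z anticommutes with it, so Y = Z forces both to
   vanish. *)
pose Y : 'M[R]_N := A *m P - P *m A - ((2 * k) *: P - 2 *: (S *m S)).
pose Z : 'M[R]_N := A *m S - S *m A - ((2 * k) *: S - (S *m P + P *m S)).
have YZ : Y = Z.
  move: rel; rewrite !(mulmxBl, mulmxBr, mulmxDr, mulmxDl) /Y /Z.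
  move: (A *m P) (P *m A) (S *m P) (P *m S) (S *m S) (A *m S) (S *m A).
  move=> AP PA SP PS SS AS SA /matrixP rel; apply/matrixP => i j.
  by move: (rel i j); rewrite !mxE; lra.
have sl a X X' : (a *: X) *m X' = a *: (X *m X') by rewrite scalemxAl.
have sr a X X' : X *m (a *: X') = a *: (X *m X') by rewrite scalemxAr.
have JY : J *m Y = Y *m J.
  rewrite /Y !(mulmxBr, mulmxBl) !sl !sr !mulmxA JA JP JS.
  rewrite mulNmx -!mulmxA JA JP JS mulmxN opprK !mulmxA.
  by [].
have JZ : J *m Z = - (Z *m J).
  rewrite /Z !(mulmxBr, mulmxBl) !(mulmxDl, mulmxDr) !sl !sr.
  rewrite !mulmxA JA JP JS !mulNmx -!mulmxA JA JP JS !mulmxN !mulmxA.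
  move: (A *m S *m J) (S *m A *m J) (S *m P *m J) (P *m S *m J) (S *m J).
  by move=> *; apply/matrixP => i j; rewrite !mxE; ring.
have Y0 : Y = 0.
  have : Y *m J = - (Y *m J) by rewrite -{1}JY {1}YZ JZ -YZ.
  move=> YJ; have YJ0 : Y *m J = 0.
    apply/matrixP => i j; move/matrixP/(_ i j): YJ; rewrite !mxE; lra.
  by rewrite -[Y]opprK -(JJl Y) YJ0 mul0mx oppr0.
have AP : A *m P - P *m A = (2 * k) *: P - 2 *: (S *m S).
  by apply/eqP; rewrite -subr_eq0 -/Y Y0.
have AS : A *m S - S *m A = (2 * k) *: S - (S *m P + P *m S).
  by apply/eqP; rewrite -subr_eq0 -/Z -YZ Y0.
have [P2 S2] := commutator_eq0 Pt St AP AS.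
split.
  have AS0 : A *m S - S *m A = 0 by rewrite AS S2 subrr.
  move: AS0; rewrite defA defS !(mulmxBl, mulmxBr, mulmxDl, mulmxDr).
  move: (M *m M) (M^T *m M^T) (M *m M^T) (M^T *m M) => a b c d /matrixP h.
  by apply/matrixP => i j; move: (h i j); rewrite !mxE; lra.
have SSS : 4 *: (S *m S *m S) = (2 * k) *: (S *m P + P *m S).
  rewrite scalerDr -(sr _ S P) -(sl _ P S) P2 sl sr mulmxA.
  by move: (S *m S *m S) => X; apply/matrixP => i j; rewrite !mxE; ring.
move: SSS; rewrite -S2.
move: (S *m S *m S) => X /matrixP h.
by apply/matrixP => i j; move: (h i j); rewrite !mxE; lra.
Qed.

End TraceIdentity.

(** * Euclidean spaces *)

Section EuclideanSpace.
Variables (R : rcfType) (H : vectType R) (g : {dot H for idfun}).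
Implicit Types (x y z : H) (F G D J E S : 'End(H)).

Lemma dotC x y : g x y = g y x.
Proof. by rewrite hermC expr0 mul1r. Qed.

Lemma dot_eq0 x : g x x = 0 -> x = 0.
Proof.
by move=> x0; apply/eqP/negPn/negP => /(neq0_dnorm_gt0 (s := g)); rewrite x0
  ltxx.
Qed.

Lemma dot_ge0 x : 0 <= g x x.
Proof.
by have [->|/(neq0_dnorm_gt0 (s := g))/ltW //] := eqVneq x 0; rewrite linear0r.
Qed.

Lemma dot_ext x y : (forall w, g x w = g y w) -> x = y.
Proof.
move=> xy; apply/eqP; rewrite -subr_eq0; apply/eqP/dot_eq0.
by rewrite linearBl /= xy subrr.
Qed.

(** Gram-Schmidt: split off a unit vector of W and recurse on its orthogonal
    complement in W. *)
Lemma orthonormal_basis_of_dim d (W : {vspace H}) : \dim W = d ->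
  exists s : seq H, [/\ size s = d, {subset s <= W},
    forall i j, (i < d)%N -> (j < d)%N -> g s`_i s`_j = (i == j)%:R &
    {in W, forall x, x = \sum_(v <- s) g x v *: v}].
Proof.
elim: d W => [|d IHd] W dimW.
  exists [::]; split=> // x; rewrite big_nil.
  by move/eqP: dimW; rewrite dimv_eq0 => /eqP ->; rewrite memv0 => /eqP.
have W0 : W != 0%VS by rewrite -dimv_eq0 dimW.
have v0 : vpick W != 0 by rewrite vpick0.
pose u := (Num.sqrt (g (vpick W) (vpick W)))^-1 *: vpick W.
have uW : u \in W by rewrite memvZ // memv_pick.
have gv := neq0_dnorm_gt0 (s := g) _ v0.
have uu : g u u = 1.
  rewrite /u linearZl_LR linearZr_LR /= mulrA -invfM -expr2 sqr_sqrtr ?ltW //.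
  by rewrite mulVf ?gt_eqF.
have uNW : u \notin orthov g W.
  by apply/mem_orthovPn; exists u => //;
    rewrite -[X in X != 0]/(g u u) uu oner_eq0.
have := eq_dim_orthov1 uNW; rewrite dimW /= => /esym/IHd [s [ss sW so sx]].
have su v : v \in s -> g v u = 0.
  by move/sW; rewrite memv_cap mem_orthov1 => /andP[_ /eqP].
exists (u :: s); split=> /=; first by rewrite ss.
- move=> v; rewrite inE => /predU1P[->//|/sW].
  by rewrite memv_cap => /andP[].
- move=> [|i] [|j] //= id jd; rewrite ?uu ?eqSS ?so //.
    by rewrite dotC su // mem_nth ?ss.
  by rewrite su // mem_nth ?ss.
move=> x xW; rewrite big_cons addrC; apply/eqP; rewrite -subr_eq; apply/eqP.
have /sx xE : x - g x u *: u \in (W :&: orthov g <[u]>)%VS.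
  rewrite memv_cap (memvB xW (memvZ _ uW)) mem_orthov1 linearBl linearZl_LR.
  by rewrite -[X in X == 0]/(g x u - g x u * g u u) uu mulr1 subrr eqxx.
rewrite [LHS]xE !big_seq; apply: eq_bigr => v vs.
by rewrite linearBl linearZl_LR /= [g u v]dotC su // mulr0 subr0.
Qed.

Definition orthonormal_basis N (e : 'I_N -> H) : Prop :=
  (forall i j, g (e i) (e j) = (i == j)%:R) /\
  (forall x, x = \sum_i g x (e i) *: e i).

Lemma exists_orthonormal_basis :
  exists N (e : 'I_N -> H), orthonormal_basis e.
Proof.
have [s [ss _ so sx]] := orthonormal_basis_of_dim (erefl (\dim {:H})).
exists (\dim {:H}), (fun i => s`_i); split=> [i j|x]; first by rewrite so.
by rewrite {1}[x]sx ?memvf // (big_nth 0) big_mkord ss.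
Qed.

Variables (N : nat) (e : 'I_N -> H).
Hypothesis eP : orthonormal_basis e.

Definition matrix_in F : 'M[R]_N := \matrix_(i, j) g (F (e j)) (e i).

Lemma matrix_in_comp F G : matrix_in (F \o G) = matrix_in F *m matrix_in G.
Proof.
apply/matrixP => i j; rewrite !mxE comp_lfunE {1}[G (e j)]eP.2.
rewrite linear_sum linear_sumlz /=; apply: eq_bigr => m _.
by rewrite linearZ linearZl_LR /= !mxE mulrC.
Qed.

Lemma matrix_in_inj F G : matrix_in F = matrix_in G -> F = G.
Proof.
move=> /matrixP FG; apply/lfunP => x; rewrite [x]eP.2 !linear_sum /=.
apply: eq_bigr => j _; rewrite !linearZ; congr (_ *: _).
rewrite [LHS]eP.2 [RHS]eP.2; apply: eq_bigr => i _.
by have := FG i j; rewrite !mxE => ->.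
Qed.

Lemma matrix_inD F G : matrix_in (F + G) = matrix_in F + matrix_in G.
Proof. by apply/matrixP => i j; rewrite !mxE add_lfunE linearDl. Qed.

Lemma matrix_inZ a F : matrix_in (a *: F) = a *: matrix_in F.
Proof. by apply/matrixP => i j; rewrite !mxE scale_lfunE linearZl_LR. Qed.

Lemma matrix_in1 : matrix_in \1 = 1%:M.
Proof. by apply/matrixP => i j; rewrite !mxE id_lfunE eP.1 eq_sym. Qed.

Lemma matrix_in_adjoint F G :
  (forall x y, g (F x) y = g x (G y)) -> (matrix_in F)^T = matrix_in G.
Proof. by move=> FG; apply/matrixP => i j; rewrite !mxE FG dotC. Qed.

(** Cyclicity of the trace for Z^T B G, written in an orthonormal basis. *)
Lemma sum_dot_adjoint (Z B : {linear H -> H}) F G :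
    (forall x y, g (F x) y = g x (G y)) ->
  \sum_i g (Z (e i)) (B (G (e i))) = \sum_i g (Z (F (e i))) (B (e i)).
Proof.
move=> FG.
under eq_bigr do rewrite [G _]eP.2 !linear_sum /=.
under [RHS]eq_bigr do rewrite [F _]eP.2 linear_sum linear_sumlz /=.
rewrite exchange_big; apply: eq_bigr => i _; apply: eq_bigr => j _.
by rewrite !linearZ linearZl_LR /= dotC -FG.
Qed.

Section NormalDerivation.
Variable b : {bilinear H -> H -> H}.

Definition derivation D : Prop :=
  forall x y, D (b x y) = b (D x) y + b x (D y).

(** Let F act on bilinear maps by
    (F.b)(x, y) = F (b x y) - b (F x) y - b x (F y), and let <b, c> be the
    Hilbert-Schmidt product. Then G acts as the adjoint of F, and the two
    actions commute because F is normal. So F.b = 0 implies F.(G.b) = 0 and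
    <G.b, G.b> = <b, F.(G.b)> = 0. *)
Lemma adjoint_normal_derivation F G :
    (forall x y, g (F x) y = g x (G y)) -> (forall x, F (G x) = G (F x)) ->
  derivation F -> derivation G.
Proof.
move=> FG comm dF.
pose z x y := G (b x y) - b (G x) y - b x (G y).
have zl y : linear (z^~ y).
  move=> a u v; rewrite /z !(linearPl, linearP) /=; apply: dot_ext => w.
  by rewrite !(linearBl, linearDl, linearNl, linearZl_LR) /=; ring.
have zr x : linear (z x).
  move=> a u v; rewrite /z !(linearPr, linearP) /=; apply: dot_ext => w.
  by rewrite !(linearBl, linearDl, linearNl, linearZl_LR) /=; ring.
pose zl' y : {linear H -> H} :=
  HB.pack (z^~ y) (GRing.isLinear.Build _ _ _ _ _ (zl y)).
pose zr' x : {linear H -> H} :=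
  HB.pack (z x) (GRing.isLinear.Build _ _ _ _ _ (zr x)).
have Fz x y : F (z x y) = z (F x) y + z x (F y).
  rewrite /z !linearB /= comm !dF !linearD /= !comm; apply: dot_ext => w.
  by rewrite !(linearBl, linearDl, linearNl) /=; ring.
(* The Hilbert-Schmidt norm of z = G.b; moving G across the product turns it
   into the pairing of F.z with b. *)
have sum0 : \sum_j \sum_i g (z (e i) (e j)) (z (e i) (e j)) = 0.
  transitivity (\sum_j \sum_i (g (F (z (e i) (e j))) (b (e i) (e j))
      - g (z (F (e i)) (e j)) (b (e i) (e j))
      - g (z (e i) (F (e j))) (b (e i) (e j)))); last first.
    rewrite big1 // => j _; rewrite big1 // => i _.
    by rewrite Fz linearDl /=; ring.
  transitivity (\sum_j \sum_i (g (z (e i) (e j)) (G (b (e i) (e j)))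
      - g (z (e i) (e j)) (b (G (e i)) (e j))
      - g (z (e i) (e j)) (b (e i) (G (e j))))).
    apply: eq_bigr => j _; apply: eq_bigr => i _.
    by rewrite {2}/z !linearBr.
  under eq_bigr do rewrite !sumrB.
  under [RHS]eq_bigr do rewrite !sumrB.
  rewrite !sumrB; congr (_ - _ - _).
  - by apply: eq_bigr => j _; apply: eq_bigr => i _; rewrite FG.
  - apply: eq_bigr => j _.
    exact: (sum_dot_adjoint (zl' (e j)) (applyr b (e j)) FG).
  rewrite exchange_big [RHS]exchange_big; apply: eq_bigr => i _.
  exact: (sum_dot_adjoint (zr' (e i)) (b (e i)) FG).
have z0 i j : z (e i) (e j) = 0.
  have ge0 := fun i j => dot_ge0 (z (e i) (e j)).
  have := psumr_eq0P _ sum0 => /(_ _ j isT) row0.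
  apply: dot_eq0; apply: (psumr_eq0P _ (row0 _)) => // k _.
  exact: sumr_ge0.
have z00 x y : z x y = 0.
  rewrite [x]eP.2 -[z _ y]/(zl' y _) linear_sum big1 // => i _.
  rewrite linearZ /= [y]eP.2 -[z (e i) _]/(zr' (e i) _) linear_sum big1 //.
    by rewrite scaler0.
  by move=> j _; rewrite linearZ /= z0 scaler0.
move=> x y; have /eqP := z00 x y.
by rewrite /z -addrA -opprD subr_eq0 => /eqP.
Qed.

End NormalDerivation.
(** * Symplectic derivations and the vanishing of the bracket *)

Section SymplecticOperators.
Variable J : 'End(H).
Hypothesis JJ : forall x, J (J x) = - x.
Hypothesis Jskew : forall x y, g (J x) y = - g x (J y).

Definition infinitesimally_symplectic F : Prop :=
  forall x y, g (F x) (J y) + g x (J (F y)) = 0.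

Lemma symplectic_adjoint F : infinitesimally_symplectic F ->
  forall x y, g (F x) y = g x ((J \o F \o J)%VF y).
Proof.
move=> Fs x y; have := Fs x (J y); rewrite JJ linearNr !comp_lfunE /=; lra.
Qed.

Lemma matrix_in_complex : matrix_in J *m matrix_in J = - 1%:M.
Proof.
rewrite -matrix_in_comp -matrix_in1 -scaleN1r -matrix_inZ; congr matrix_in.
by apply/lfunP => x; rewrite comp_lfunE scale_lfunE id_lfunE JJ scaleN1r.
Qed.

Lemma matrix_in_complex_tr : (matrix_in J)^T = - matrix_in J.
Proof.
rewrite -scaleN1r -matrix_inZ; apply: matrix_in_adjoint => x y.
by rewrite Jskew scale_lfunE scaleN1r linearNr.
Qed.

(** F^T = JFJ and J^2 = -1 give tr F = tr (JFJ) = - tr F. *)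
Lemma symplectic_trace F : infinitesimally_symplectic F ->
  \sum_i g (F (e i)) (e i) = 0.
Proof.
move=> Fs; have trE : \tr (matrix_in F) = \sum_i g (F (e i)) (e i).
  by apply: eq_bigr => i _; rewrite mxE.
have := mxtrace_tr (matrix_in F).
rewrite (matrix_in_adjoint (symplectic_adjoint Fs)) !matrix_in_comp.
rewrite mxtrace_mulC mulmxA matrix_in_complex mulNmx mul1mx linearN /= trE.
by lra.
Qed.

Lemma symplectic_pair_normal M E (k : R) :
    infinitesimally_symplectic M -> infinitesimally_symplectic E ->
    (forall x, M (E x) - E (M x) = k *: E x) ->
    (forall x, E (J x) - J (E x) = M x + J (M (J x))) ->
  let M' := (J \o M \o J)%VF in
  (forall x, M (M' x) = M' (M x)) /\
  (forall x, (M + M')%R ((M + M')%R ((M + M')%R x)) = k ^+ 2 *: (M + M')%R x).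
Proof.
move=> Ms Es ME EJ M'.
have tr F : infinitesimally_symplectic F ->
    (matrix_in F)^T = matrix_in J *m matrix_in F *m matrix_in J.
  by move=> /symplectic_adjoint/matrix_in_adjoint ->; rewrite !matrix_in_comp.
have MEm : matrix_in M *m matrix_in E - matrix_in E *m matrix_in M
    = k *: matrix_in E.
  rewrite -!matrix_in_comp -matrix_inZ -scaleN1r -matrix_inZ -matrix_inD.
  congr matrix_in; apply/lfunP => x.
  by rewrite add_lfunE !scale_lfunE !comp_lfunE scaleN1r ME.
have EJm : matrix_in E *m matrix_in J - matrix_in J *m matrix_in E
    = matrix_in M + matrix_in J *m matrix_in M *m matrix_in J.
  rewrite -!matrix_in_comp -matrix_inD -scaleN1r -matrix_inZ -matrix_inD.
  congr matrix_in; apply/lfunP => x.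
  by rewrite !add_lfunE scale_lfunE !comp_lfunE scaleN1r EJ.
have NM : (matrix_in M)^T = matrix_in M' by rewrite tr // -!matrix_in_comp.
have [] := holomorphic_pair_normal matrix_in_complex matrix_in_complex_tr
             (tr M Ms) (tr E Es) MEm EJm.
rewrite NM -!matrix_in_comp -matrix_inD -!matrix_in_comp -matrix_inZ.
move=> /matrix_in_inj MN /matrix_in_inj SSS; split=> x.
  by move/lfunP/(_ x): MN; rewrite !comp_lfunE.
by move/lfunP/(_ x): SSS; rewrite !comp_lfunE scale_lfunE.
Qed.

End SymplecticOperators.

(** S is diagonalisable with eigenvalues 0, k and -k. A bracket of eigenvectors
    with eigenvalues p = ik and q = jk has eigenvalue (i + j) k - 1, which is
    not a multiple lk with |l| <= 1 since (i + j - l) k = 1 is impossible for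
    integers and k > 1. *)
Lemma bilinear_weight_eq0 (b : {bilinear H -> H -> H}) S (k : R) : 1 < k ->
    (forall x, S (S (S x)) = k ^+ 2 *: S x) ->
    (forall x y, S (b x y) = b (S x) y + b x (S y) - b x y) ->
  forall x y, b x y = 0.
Proof.
move=> k1 S3 Sb.
have k0 : k != 0 by rewrite gt_eqF //; lra.
have weight0 x y (p q : R) : S x = p *: x -> S y = q *: y ->
    (p + q - 1) * ((p + q - 1) ^+ 2 - k ^+ 2) != 0 -> b x y = 0.
  move=> Sx Sy; have Sbxy : S (b x y) = (p + q - 1) *: b x y.
    rewrite Sb Sx Sy linearZl_LR linearZr_LR /=.
    by rewrite !(scalerDl, scaleN1r, scalerBl).
  move: (p + q - 1) Sbxy => l Sbxy /negPf l0.
  have := S3 (b x y); rewrite Sbxy !linearZ /= Sbxy linearZ /= Sbxy => lE.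
  have : (l * l * l - k ^+ 2 * l) *: b x y = 0.
    rewrite scalerBl [k ^+ 2 * l]mulrC -(scalerA l (k ^+ 2)) -lE.
    by rewrite !scalerA subrr.
  have -> : l * l * l - k ^+ 2 * l = l * (l ^+ 2 - k ^+ 2) by ring.
  by move=> /eqP; rewrite scaler_eq0 l0 => /eqP.
have SZ a u : S (a *: u) = a *: S u by rewrite linearZ.
have split3 x : exists x0 xp xm, [/\ x = x0 + xp + xm, S x0 = 0 *: x0,
    S xp = k *: xp & S xm = - k *: xm].
  (* The Lagrange interpolation polynomials of S at 0, k and -k. *)
  exists (x - (k ^+ 2)^-1 *: S (S x)).
  exists ((2 * k ^+ 2)^-1 *: (S (S x) + k *: S x)).
  exists ((2 * k ^+ 2)^-1 *: (S (S x) - k *: S x)).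
  split; apply: dot_ext => w.
  - rewrite !(linearBl, linearDl, linearNl, linearZl_LR) /=; field.
    exact: k0.
  - rewrite scale0r linear0l linearB linearZ /= S3 scalerA mulVf ?expf_neq0 //.
    by rewrite scale1r subrr linear0l.
  - rewrite SZ linearD /= S3 SZ.
    by rewrite !(linearBl, linearDl, linearNl, linearZl_LR) /=; field.
  - rewrite SZ linearB /= S3 SZ.
    by rewrite !(linearBl, linearDl, linearNl, linearZl_LR) /=; field.
move=> x y.
have [x0 [xp [xm [-> Sx0 Sxp Sxm]]]] := split3 x.
have [y0 [yp [ym [-> Sy0 Syp Sym]]]] := split3 y.
have nz (l : R) : l != 0 -> l - k != 0 -> l + k != 0 ->
    l * (l ^+ 2 - k ^+ 2) != 0.
  by move=> l0 lk lk'; rewrite subr_sqr !mulf_neq0.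
have nz1 (m : R) : m < 0 \/ 0 < m -> m != 0.
  by rewrite neq_lt => -[] ->; rewrite ?orbT.
rewrite !(linearDl, linearDr) /=.
rewrite (weight0 _ _ _ _ Sx0 Sy0) ?(weight0 _ _ _ _ Sx0 Syp);
rewrite ?(weight0 _ _ _ _ Sx0 Sym) ?(weight0 _ _ _ _ Sxp Sy0);
rewrite ?(weight0 _ _ _ _ Sxp Syp) ?(weight0 _ _ _ _ Sxp Sym);
rewrite ?(weight0 _ _ _ _ Sxm Sy0) ?(weight0 _ _ _ _ Sxm Syp);
rewrite ?(weight0 _ _ _ _ Sxm Sym) ?addr0 //.
all: apply: nz; apply: nz1; (left; lra) || (right; lra).
Qed.

Lemma symplectic_of_scaling J D :
    (forall x y, g (D x) (J y) + g x (J (D y)) = - g x (J y)) ->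
  infinitesimally_symplectic J (D + 2^-1 *: \1%VF).
Proof.
move=> DJ x y; have := DJ x y.
rewrite !add_lfunE !scale_lfunE !id_lfunE.
by rewrite !linearD linearDl !linearZ linearZl_LR /=; lra.
Qed.

Lemma scaling_trace J D : (forall x, J (J x) = - x) ->
    (forall x y, g (D x) (J y) + g x (J (D y)) = - g x (J y)) ->
  \sum_i g (D (e i)) (e i) = - (N%:R / 2).
Proof.
move=> JJ /symplectic_of_scaling/(symplectic_trace JJ).
under eq_bigr do rewrite add_lfunE scale_lfunE id_lfunE linearDl linearZl_LR
  /= eP.1 eqxx mulr1.
by rewrite big_split /= sumr_const card_ord -mulr_natl; lra.
Qed.

(** Adding 1/2 to D makes it symplectic, so [symplectic_pair_normal] applies
    to M = D + 1/2. Both D and its adjoint are derivations of b, so their sum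
    is S - 1 where S = M + M^T has eigenvalues 0, k and -k. *)
Lemma abelian_of_scaling_derivation (b : {bilinear H -> H -> H}) J D E
    (k : R) :
    1 < k -> (forall x, J (J x) = - x) ->
    (forall x y, g (J x) y = - g x (J y)) ->
    (forall x y, g (D x) (J y) + g x (J (D y)) = - g x (J y)) ->
    infinitesimally_symplectic J E ->
    (forall x, D (E x) - E (D x) = k *: E x) ->
    (forall x, E (J x) - J (E x) = D x + J (D (J x))) ->
    derivation b D ->
  forall x y, b x y = 0.
Proof.
move=> k1 JJ Jskew DJ Es DE EJ dD.
have Ms := symplectic_of_scaling DJ.
set M : 'End(H) := D + 2^-1 *: \1%VF in Ms.
have ME x : M x = D x + 2^-1 *: x by rewrite add_lfunE scale_lfunE id_lfunE.
have [|x|MN S3] := symplectic_pair_normal JJ Jskew Ms Es (k := k).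
- move=> x; rewrite -DE !ME linearD linearZ /=; apply: dot_ext => w.
  by rewrite !(linearBl, linearDl, linearNl, linearZl_LR) /=; ring.
- rewrite EJ !ME linearD linearZ /= JJ; apply: dot_ext => w.
  by rewrite !(linearBl, linearDl, linearNl, linearZl_LR) /=; ring.
set M' := (J \o M \o J)%VF in MN S3.
pose Dt : 'End(H) := M' - 2^-1 *: \1%VF.
have M'E x : M' x = Dt x + 2^-1 *: x.
  by rewrite /Dt add_lfunE opp_lfunE scale_lfunE id_lfunE subrK.
have dDt : derivation b Dt.
  apply: (adjoint_normal_derivation (F := D)) => // [x y|x].
    have := symplectic_adjoint JJ Ms x y; rewrite -/M' M'E ME linearDl linearDr.
    by rewrite linearZl_LR linearZr_LR /=; lra.
  have := MN x; rewrite !ME !M'E !linearD !linearZ /= => h; apply: dot_ext => w.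
  by move: (congr1 (g^~ w) h); rewrite !(linearDl, linearZl_LR) /= ; lra.
apply: (bilinear_weight_eq0 k1 S3) => x y.
have SE u : (M + M')%R u = D u + Dt u + u.
  rewrite add_lfunE ME M'E; apply: dot_ext => w.
  by rewrite !(linearDl, linearZl_LR) /=; field.
rewrite !SE dD dDt !(linearDl, linearDr) /=; apply: dot_ext => w.
by rewrite !(linearBl, linearDl) /=; ring.
Qed.

(** In an orthonormal basis (e_0, e_1) the trace of b(e_i, -) is the component
    of b(e_i, e_j) along e_j, for j the other index. *)
Lemma unimodular_plane_abelian (b : {bilinear H -> H -> H}) : N = 2%N ->
    (forall x, b x x = 0) -> (forall x, \sum_i g (b x (e i)) (e i) = 0) ->
  forall x y, b x y = 0.
Proof.
move=> N2 bxx trb.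
have bC x y : b y x = - b x y.
  have := bxx (x + y); rewrite linearDl !linearDr /= !bxx add0r addr0 => /eqP.
  by rewrite addr_eq0 => /eqP ->; rewrite opprK.
have bee i j : b (e i) (e j) = 0.
  have [->//|ij] := eqVneq i j.
  have two l : (l == i) || (l == j).
    move: i j l ij; rewrite N2 => i j l.
    by case: i j l => [[|[|]]] // ? [[|[|]]] // ? [[|[|]]].
  have diag x (l m : 'I_N) : (l == i) && (m == j) || (l == j) && (m == i) ->
      b x (e m) = 0 -> g (b x (e l)) (e l) = 0.
    move=> lm xm; have := trb x; rewrite (bigD1 l) //= (bigD1 m) /=; last first.
      by case/orP: lm => /andP[/eqP-> /eqP->]; rewrite // eq_sym.
    rewrite xm linear0l add0r big1 ?addr0 // => p /andP[pl pm].
    by have := two p;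
      case/orP: lm pl pm => /andP[/eqP-> /eqP->] /negPf-> /negPf->.
  rewrite [LHS]eP.2 big1 // => l _; case/orP: (two l) => /eqP ->.
    by rewrite bC linearNl /= (diag _ i j) ?eqxx ?bxx ?oppr0 ?scale0r.
  by rewrite (diag _ j i) ?eqxx ?orbT ?bxx ?scale0r.
move=> x y; rewrite [x]eP.2 linear_sumlz big1 // => i _.
rewrite [y]eP.2 linear_sum big1 // => j _.
by rewrite /= linearZr_LR linearZl_LR /= bee !scaler0.
Qed.

End EuclideanSpace.

(** * The complement of the Lee and anti-Lee vectors *)

(** Any family with the reconstruction property of an orthonormal basis computes
    the trace; this avoids relating such a family to the chosen basis of T. *)
Lemma trace_parseval (R : rcfType) (T : vectType R) (g : {dot T for idfun})
    (I : finType) (f : I -> T) (F : 'End(T)) :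
    (forall x, x = \sum_i g x (f i) *: f i) ->
  \tr (passmx.mxof (vbasis {:T}) (vbasis {:T}) F) = \sum_i g (F (f i)) (f i).
Proof.
move=> fx; pose vb := vbasis {:T}.
transitivity
  (\sum_(a < \dim {:T}) \sum_i g (vb`_a) (f i) * coord vb a (F (f i))).
  apply: eq_bigr => a _.
  rewrite mxE /= !mxE /= passmx.vecof_delta {1}[_`_a]fx !linear_sum /=.
  by apply: eq_bigr => i _; rewrite !linearZ.
rewrite exchange_big; apply: eq_bigr => i _.
rewrite {2}[F (f i)](coord_vbasis (memvf _)) linear_sumlz /=.
by apply: eq_bigr => a _; rewrite linearZl_LR mulrC.
Qed.

Lemma endo_onE (R : realType) (T : vectType R) (h : {vspace T}) (F : 'End(T))
    (x : subvs_of h) : F (vsval x) \in h -> vsval (endo_on h F x) = F (vsval x).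
Proof. by move=> Fx; rewrite !comp_lfunE !lfunE /= vsprojK. Qed.

Section LCK.
Variables (R : realType) (T : vectType R) (br : {bilinear T -> T -> T}).
Variables (g : {dot T for idfun}) (J : 'End(T)) (theta eta : 'Hom(T, R^o)).
Variables (U V : T).
Hypotheses (hbr : lie_bracket br) (hlck : lck_structure br g J theta eta).
Hypotheses (hU : metric_dual g theta U) (hV : metric_dual g eta V).
Hypotheses (hnorm : g U U = 1) (hint : integrable br eta).
Implicit Types (x y : T).

Let h := orthov g <<[:: U; V]>>%VS.

Lemma br_skew x y : br y x = - br x y.
Proof.
have := hbr.1 (x + y).
rewrite linearDl !linearDr /= !hbr.1 add0r addr0 => /eqP.
by rewrite addr_eq0 => /eqP ->; rewrite opprK.
Qed.

Lemma lck_JJ x : J (J x) = - x.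
Proof. exact: (lck_complex hlck).1. Qed.

Lemma lck_J_skew x y : g (J x) y = - g x (J y).
Proof.
have := lck_two_form hlck (x + y); rewrite /fundamental_form.
have := lck_two_form hlck x; have := lck_two_form hlck y.
rewrite /fundamental_form linearD linearDl !linearDr /= => -> ->.
by rewrite [g (J x) y]dotC; lra.
Qed.

Lemma antiLeeE : V = J U.
Proof.
by apply: (dot_ext (g := g)) => w; rewrite -hV (lck_eta hlck) hU lck_J_skew.
Qed.

Lemma J_antiLee : J V = - U. Proof. by rewrite antiLeeE lck_JJ. Qed.

Lemma eta_J x : eta (J x) = theta x.
Proof. by rewrite (lck_eta hlck) lck_JJ linearN opprK. Qed.

Lemma theta_J x : theta (J x) = - eta x.
Proof. by rewrite (lck_eta hlck) opprK. Qed.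

Lemma theta_U : theta U = 1. Proof. by rewrite hU hnorm. Qed.

Lemma eta_V : eta V = 1. Proof. by rewrite antiLeeE eta_J theta_U. Qed.

Lemma eta_U : eta U = 0.
Proof.
have := lck_two_form hlck U.
by rewrite /fundamental_form -antiLeeE dotC -hV.
Qed.

Lemma theta_V : theta V = 0. Proof. by rewrite antiLeeE theta_J eta_U oppr0. Qed.

Lemma mem_Lee_perp x : (x \in h) = (theta x == 0) && (eta x == 0).
Proof.
apply/mem_orthovP/andP => [xh|[/eqP tx /eqP ex] v].
  rewrite hU hV dotC [g V x]dotC.
  by split; apply/eqP/xh/memv_span; rewrite !inE eqxx ?orbT.
rewrite span_cons span_seq1 => /memv_addP[_ /vlineP[a ->] [_ /vlineP[c ->] ->]].
rewrite linearDr !linearZr_LR -[LHS]/(a * g x U + c * g x V).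
by rewrite ![g x _]dotC -hU -hV tx ex !mulr0 addr0.
Qed.

Lemma Lee_perpP x : x \in h -> theta x = 0 /\ eta x = 0.
Proof. by rewrite mem_Lee_perp => /andP[/eqP ? /eqP ?]. Qed.

Lemma theta_br x y : theta (br x y) = 0.
Proof.
by have /eqP := lck_theta_closed hlck x y; rewrite oppr_eq0 => /eqP.
Qed.

(** Integrability of the distribution ker eta, tested against V. *)
Lemma eta_br x y : eta x = 0 -> eta y = 0 -> eta (br x y) = 0.
Proof.
move=> ex ey; have := hint V x y.
by rewrite /wedge12 /dform1 ex ey eta_V !mul0r !addr0 mul1r => /eqP;
  rewrite oppr_eq0 => /eqP.
Qed.

Lemma Lee_perp_J x : x \in h -> J x \in h.
Proof.
by rewrite !mem_Lee_perp => /andP[/eqP tx /eqP ex]; 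
  rewrite eta_J theta_J tx ex oppr0 eqxx.
Qed.

Lemma linform_scale (a : 'Hom(T, R^o)) (k : R) x : a (k *: x) = k * a x.
Proof. by rewrite linearZ. Qed.

Lemma br_Lee_perp x y : x \in h -> y \in h -> br x y \in h.
Proof.
move=> /Lee_perpP[_ ex] /Lee_perpP[_ ey].
by rewrite mem_Lee_perp theta_br eta_br ?eqxx.
Qed.

Lemma br_U_Lee_perp y : y \in h -> br U y \in h.
Proof.
move=> /Lee_perpP[_ ey].
by rewrite mem_Lee_perp theta_br eta_br ?eta_U ?eqxx.
Qed.

(** The vanishing of N_J(U, x), where JU = V, says that the commutator of ad V
    with J is J times the commutator of ad U with J. *)
Lemma nijenhuis_U x :
  br V (J x) - J (br V x) = br U x + J (br U (J x)).
Proof.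
have := (lck_complex hlck).2 U x; rewrite /nijenhuis -antiLeeE => N0.
apply: (dot_ext (g := g)) => w; have := congr1 (g^~ w) N0.
by rewrite !(linearBl, linearDl, linear0l) /=; lra.
Qed.

(** Apply eta to N_J(U, - J y) = 0: the terms with a leading J become values of
    theta on brackets, and only eta [V, y] and eta [U, - J y] = 0 remain. *)
Lemma br_V_Lee_perp y : y \in h -> br V y \in h.
Proof.
move=> yh; rewrite mem_Lee_perp theta_br eqxx /=.
have Jyh : - J y \in h by rewrite memvN Lee_perp_J.
have xE : J (- J y) = y by rewrite linearN /= lck_JJ opprK.
have := congr1 eta (nijenhuis_U (- J y)).
rewrite xE linearB linearD /= !eta_J !theta_br.
by rewrite subr0 addr0 => ->; rewrite eta_br ?eta_U ?(Lee_perpP Jyh).2.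
Qed.

Lemma Lee_perp_split x :
  exists x0, x0 \in h /\ x = x0 + theta x *: U + eta x *: V.
Proof.
exists (x - theta x *: U - eta x *: V); split; last by rewrite addrAC !subrK.
rewrite mem_Lee_perp !linearB /= !linform_scale theta_U theta_V eta_U eta_V.
by rewrite !mulr1 !mulr0 !subr0 !subrr eqxx.
Qed.

Lemma ideal_Lee_perp x y : y \in h -> br x y \in h.
Proof.
move=> yh; have [x0 [x0h ->]] := Lee_perp_split x.
rewrite !linearDl !linearZl_LR /=.
apply: memvD; last by rewrite memvZ ?br_V_Lee_perp.
by apply: memvD; [apply: br_Lee_perp | rewrite memvZ ?br_U_Lee_perp].
Qed.

(** d(Omega) on (U, V, x) with x in h shows that [U, V] is orthogonal to J x,
    hence to h; closedness of theta removes the component along U. *)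
Lemma br_UV : br U V = eta (br U V) *: V.
Proof.
set c := eta (br U V); pose W := br U V - c *: V.
have Wh : W \in h.
  rewrite mem_Lee_perp !linearB /= !linform_scale theta_br theta_V eta_V.
  by rewrite mulr0 mulr1 !subrr eqxx.
have UVh y : y \in h -> g (br U V) y = 0.
  move=> yh; have [x [xh xE]] : exists x, x \in h /\ J x = y.
    by exists (- J y); rewrite memvN Lee_perp_J // linearN /= lck_JJ opprK.
  have := lck_dfundamental hlck U V x.
  rewrite /dform2 /wedge12 /fundamental_form xE theta_V theta_U (Lee_perpP xh).1.
  rewrite -antiLeeE J_antiLee (linearNr g) /= -hV (Lee_perpP yh).2.
  rewrite [g _ V]dotC [g _ U]dotC -hV -hU theta_br.
  rewrite (Lee_perpP (br_V_Lee_perp xh)).2.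
  by lra.
apply/eqP; rewrite -subr_eq0 -/W; apply/eqP/(dot_eq0 (g := g)).
rewrite {1}/W linearBl linearZl_LR /= UVh // -hV (Lee_perpP Wh).2.
by rewrite mulr0 subr0.
Qed.

(** d(Omega) = theta /\ Omega on (U, x, y). *)
Lemma scaling_U x y : x \in h -> y \in h ->
  g (br U x) (J y) + g x (J (br U y)) = - g x (J y).
Proof.
move=> xh yh; have := lck_dfundamental hlck U x y.
rewrite /dform2 /wedge12 /fundamental_form theta_U (Lee_perpP xh).1.
rewrite (Lee_perpP yh).1.
rewrite -antiLeeE [g _ V]dotC -hV (Lee_perpP (br_Lee_perp xh yh)).2.
rewrite [br y U]br_skew linearNl /= [g _ (J x)]dotC lck_J_skew.
by lra.
Qed.

(** d(Omega) = theta /\ Omega on (V, x, y), where theta V = 0. *)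
Lemma symplectic_V x y : x \in h -> y \in h ->
  g (br V x) (J y) + g x (J (br V y)) = 0.
Proof.
move=> xh yh; have := lck_dfundamental hlck V x y.
rewrite /dform2 /wedge12 /fundamental_form theta_V (Lee_perpP xh).1.
rewrite (Lee_perpP yh).1.
rewrite J_antiLee (linearNr g) /= [g _ U]dotC -hU theta_br.
rewrite [br y V]br_skew linearNl /= [g _ (J x)]dotC lck_J_skew.
by lra.
Qed.

Lemma ad_derivation x y z : br x (br y z) = br (br x y) z + br y (br x z).
Proof.
have := hbr.2 x y z; rewrite [br z x]br_skew [br z _]br_skew linearNr.
rewrite -addrA -opprD => /eqP; rewrite subr_eq0 => /eqP ->.
by rewrite addrC.
Qed.

Lemma commutator_UV x :
  br U (br V x) - br V (br U x) = eta (br U V) *: br V x.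
Proof. by rewrite ad_derivation addrK {1}br_UV linearZl_LR. Qed.

(** * The restricted structure *)

Let gh : {dot subvs_of h for idfun} := dot_on (h:=h) g.
Let brh : {bilinear subvs_of h -> subvs_of h -> subvs_of h} :=
  bracket_on (h:=h) br.
Let Jh := endo_on h J.
Let Dh := endo_on h (linfun (br U)).
Let Eh := endo_on h (linfun (br V)).

Lemma ghE (x y : subvs_of h) : gh x y = g (vsval x) (vsval y).
Proof. by []. Qed.

Lemma brhE (x y : subvs_of h) : vsval (brh x y) = br (vsval x) (vsval y).
Proof. by rewrite /brh /= /bracket_on vsprojK // ideal_Lee_perp ?subvsP. Qed.

Lemma JhE (x : subvs_of h) : vsval (Jh x) = J (vsval x).
Proof. by rewrite endo_onE // Lee_perp_J ?subvsP. Qed.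

Lemma DhE (x : subvs_of h) : vsval (Dh x) = br U (vsval x).
Proof. by rewrite endo_onE lfunE //= ideal_Lee_perp ?subvsP. Qed.

Lemma EhE (x : subvs_of h) : vsval (Eh x) = br V (vsval x).
Proof. by rewrite endo_onE lfunE //= ideal_Lee_perp ?subvsP. Qed.

Lemma Jh_square (x : subvs_of h) : Jh (Jh x) = - x.
Proof. by apply: val_inj; rewrite /= !JhE lck_JJ. Qed.

Lemma scaling_Dh (x y : subvs_of h) :
  gh (Dh x) (Jh y) + gh x (Jh (Dh y)) = - gh x (Jh y).
Proof. by rewrite !ghE !JhE !DhE scaling_U ?subvsP. Qed.

Section Basis.
Variables (N : nat) (e : 'I_N -> subvs_of h).
Hypothesis eP : orthonormal_basis gh e.

Let f (i : bool + 'I_N) : T :=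
  match i with inl c => if c then U else V | inr i => vsval (e i) end.

Lemma adapted_sum (F : T -> R) :
  \sum_i F (f i) = F U + F V + \sum_i F (vsval (e i)).
Proof. by rewrite big_sumType big_bool. Qed.

Lemma adapted_parseval x : x = \sum_i g x (f i) *: f i.
Proof.
have [x0 [x0h xE]] := Lee_perp_split x.
have exp0 : x0 = \sum_i g x (vsval (e i)) *: vsval (e i).
  rewrite -{1}(vsprojK x0h) [vsproj h x0]eP.2 linear_sum.
  apply: eq_bigr => i _; rewrite linearZ ghE vsprojK // xE !linearDl /=.
  have [ti ei] := Lee_perpP (subvsP (e i)).
  by rewrite !linearZl_LR /= -hU -hV ti ei !mulr0 !addr0.
rewrite big_sumType big_bool /= -exp0 [g x U]dotC [g x V]dotC -hU -hV.
by rewrite [LHS]xE [RHS]addrC addrA.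
Qed.

Lemma adapted_trace (F : 'End(T)) :
  \tr (passmx.mxof (vbasis {:T}) (vbasis {:T}) F)
  = theta (F U) + eta (F V) + \sum_i g (F (vsval (e i))) (vsval (e i)).
Proof.
rewrite (trace_parseval F adapted_parseval) (adapted_sum (fun v => g (F v) v)).
by rewrite [g _ U]dotC [g _ V]dotC -hU -hV.
Qed.

(** The trace of the identity counts the vectors of the adapted family. *)
Lemma adapted_dim : \dim {:T} = (N + 2)%N.
Proof.
have := adapted_trace \1%VF.
rewrite (passmx.mxof1 (basis_free (vbasisP _))) mxtrace1 !id_lfunE theta_U eta_V.
under eq_bigr do rewrite id_lfunE -ghE eP.1 eqxx.
rewrite sumr_const card_ord => dT.
by apply/eqP; rewrite -(eqr_nat R) dT natrD addrC.
Qed.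

Hypothesis hunim : unimodular br.

(** tr (ad U) is the sum of 0 from U, eta [U, V] from V, and tr D = - N / 2. *)
Lemma eta_UV : eta (br U V) = N%:R / 2.
Proof.
have := hunim U; rewrite adapted_trace !lfunE /= hbr.1 linear0 add0r.
under eq_bigr do rewrite lfunE /= -DhE -ghE.
by rewrite (scaling_trace eP Jh_square scaling_Dh) => /eqP;
  rewrite subr_eq0 => /eqP.
Qed.

(** For x in h, ad x maps U and V into h, so U and V do not contribute to
    tr (ad x). *)
Lemma unimodular_Lee_perp (x : subvs_of h) : \sum_i gh (brh x (e i)) (e i) = 0.
Proof.
have := hunim (vsval x); rewrite adapted_trace !lfunE /= theta_br.
have Vh := br_V_Lee_perp (subvsP x).
rewrite br_skew linearN /= (Lee_perpP Vh).2 oppr0 !add0r => tr0; rewrite -[RHS]tr0.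
by apply: eq_bigr => i _; rewrite lfunE ghE brhE.
Qed.

End Basis.

Lemma abelian_Lee_perp n : \dim {:T} = (2 * n + 2)%N -> (1 <= n)%N ->
  unimodular br -> forall x y : subvs_of h, brh x y = 0.
Proof.
move=> dimT n1 hunim.
have [N [e eP]] := exists_orthonormal_basis gh.
have N2n : N = (2 * n)%N.
  by apply/eqP; rewrite -(eqn_add2r 2) -(adapted_dim eP) dimT.
have cn : eta (br U V) = n%:R.
  by rewrite (eta_UV eP hunim) N2n natrM mulrAC divff ?mul1r ?pnatr_eq0.
have [n_gt1|] := ltnP 1 n; last first.
  rewrite leq_eqVlt ltnNge n1 orbF => /eqP n_eq1.
  apply: (unimodular_plane_abelian eP) => [|x|x]; first by rewrite N2n n_eq1.
    by apply: val_inj; rewrite /= brhE hbr.1.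
  exact: unimodular_Lee_perp.
apply: (abelian_of_scaling_derivation eP (J := Jh) (D := Dh) (E := Eh)
          (k := n%:R)).
- by rewrite ltr1n.
- exact: Jh_square.
- by move=> x y; rewrite !ghE !JhE lck_J_skew.
- exact: scaling_Dh.
- by move=> x y; rewrite !ghE !JhE !EhE symplectic_V ?subvsP.
- move=> x; apply: val_inj.
  by rewrite /= !(DhE, EhE) commutator_UV cn.
- move=> x; apply: val_inj.
  by rewrite /= !(JhE, EhE, DhE) nijenhuis_U.
- move=> x y; apply: val_inj.
  by rewrite /= !(brhE, DhE) ad_derivation.
Qed.

End LCK.

Theorem theorem4p5 (R : realType) (T : vectType R) (n : nat)
    (hn : (1 <= n)%N) (hdim : \dim {:T} = (2 * n + 2)%N)
    (br : {bilinear T -> T -> T}) (hbr : lie_bracket br)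
    (g : {dot T for idfun}) (J : 'End(T)) (theta eta : 'Hom(T, R^o))
    (hlck : lck_structure br g J theta eta)
    (U V : T) (hU : metric_dual g theta U) (hV : metric_dual g eta V)
    (hnorm : g U U = 1)
    (hunim : unimodular br) (hint : integrable br eta) :
  let h := orthov g <<[:: U; V]>>%VS in
  [/\ ideal br h, abelian_on br h, (J @: h <= h)%VS &
      kahler_lie_algebra (bracket_on (h:=h) br) (dot_on (h:=h) g) (endo_on h J)].
Proof.
move=> h.
have br0 := abelian_Lee_perp hbr hlck hU hV hnorm hint hdim hn hunim.
have Jh := Lee_perp_J hlck hU hV.
split.
- exact: ideal_Lee_perp hlck hU hV hnorm hint.
- move=> x y xh yh; have /(congr1 vsval) := br0 (vsproj h x) (vsproj h y).
  by rewrite (brhE hlck hU hV hnorm hint) !vsprojK // linear0.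
- by apply/subvP => _ /memv_imgP[x xh ->]; apply: Jh.
split.
- by split=> [x|x y z]; rewrite !br0 ?addr0.
- split=> [x|x y]; first exact: Jh_square hlck hU hV _.
  by rewrite /nijenhuis !br0 !linear0 !addr0.
- move=> x y; rewrite -[LHS]/(g (vsval _) (vsval _)) !(JhE hlck hU hV).
  by rewrite (lck_J_skew hlck) (lck_JJ hlck) linearNr opprK.
- by move=> x y z; rewrite /dform2 /fundamental_form !br0 !linear0l !subr0 oppr0.
Qed.
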